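(* Let $M$ be a matching with a separated layout, and let $k$ be the largest integer such that $M$ contains a $k$-thick pattern (i.e. the largest thick pattern in $M$ has size $k\times k$). Then $k\le\mathrm{mn}(M)\le 2k^7$.
   Context: An ordered graph is a graph with a total order $\prec$ on its vertices. Two edges $uv$, $xy$ ($u\prec v$, $x\prec y$, four distinct endpoints) cross if $u\prec x\prec v\prec y$ or $x\prec u\prec y\prec v$ and nest if $u\prec x\prec y\prec v$ or $x\prec u\prec v\prec y$. A stack (queue) is an edge set with no two crossing (nesting) edges; $\mathrm{mn}(G)$ is the minimum $s+q$ such that the edges can be partitioned into $s$ stacks and $q$ queues. A layout of a bipartite graph with bipartition $V_1\cup V_2$ is separated if all of $V_1$ precedes all of $V_2$. A $k$-twist ($k$-rainbow) is a set of $k$ pairwise crossing (nesting) edges. A $t$-thick $k$-twist consists of $k$ pairwise vertex-disjoint $t$-rainbows such that every edge crosses every edge of the other rainbows; a $t$-thick $k$-rainbow consists of $k$ pairwise vertex-disjoint $t$-twists such that every edge nests with every edge of the other twists. A $k$-thick pattern is a $k$-thick $k$-twist or a $k$-thick $k$-rainbow. An ordered graph contains a pattern if it has a subgraph isomorphic to it via an order-preserving isomorphism. *)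

(* Defs.v *)
From HB Require Import structures.
From mathcomp Require Import all_boot all_order.

Set Implicit Arguments.
Unset Strict Implicit.
Unset Printing Implicit Defensive.

Import Order.TTheory.
Local Open Scope order_scope.

Record ograph d (V : finOrderType d) := OGraph {
  adj :> rel V;
  adj_sym : symmetric adj;
  adj_irr : irreflexive adj
}.

Section OrderedGraphs.
Context {d : Order.disp_t} {V : finOrderType d}.
Implicit Types (G H : ograph V) (e f : V * V) (F S Q : {set V * V}).

(* An edge is encoded by the pair (left endpoint, right endpoint), so each
   undirected edge occurs exactly once. *)
Definition edges G : {set V * V} := [set e | (e.1 < e.2) && adj G e.1 e.2].

Definition cross e f : bool :=
  [&& e.1 < f.1, f.1 < e.2 & e.2 < f.2] || [&& f.1 < e.1, e.1 < f.2 & f.2 < e.2].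

Definition nest e f : bool :=
  [&& e.1 < f.1, f.1 < f.2 & f.2 < e.2] || [&& f.1 < e.1, e.1 < e.2 & e.2 < f.2].

Definition is_stack S : bool := [forall e in S, forall f in S, ~~ cross e f].
Definition is_queue Q : bool := [forall e in Q, forall f in Q, ~~ nest e f].

(* The blocks of [partition] are nonempty; this does not affect the minimum. *)
Definition mixed_layout G (s q : nat) : bool :=
  [exists St : {set {set V * V}}, exists Qu : {set {set V * V}},
    [&& partition (St :|: Qu) (edges G), [disjoint St & Qu],
        #|St| == s, #|Qu| == q,
        [forall S in St, is_stack S] & [forall Q in Qu, is_queue Q]]].

Definition mixed_pages G (n : nat) : bool :=
  [exists s : 'I_n.+1, mixed_layout G s (n - s)].

Lemma mixed_pages_ex G : exists n, mixed_pages G n.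
Proof.
pose P := preim_partition id (edges G).
exists #|P|; apply/existsP; exists ord_max; rewrite /= subnn.
apply/existsP; exists P; apply/existsP; exists set0.
rewrite setU0 preim_partitionP disjoint_sym disjoints_subset sub0set eqxx cards0 /=.
apply/andP; split; last by apply/forallP => Q; rewrite inE.
apply/forall_inP => S /imsetP[x _ ->].
apply/forall_inP => e; rewrite inE => /andP[_ /eqP <-].
apply/forall_inP => f; rewrite inE => /andP[_ /eqP <-].
by rewrite /cross !ltxx.
Qed.

Definition mn G : nat := ex_minn (mixed_pages_ex G).

Definition is_twist (k : nat) F : Prop :=
  #|F| = k /\ {in F &, forall e f, e != f -> cross e f}.

Definition is_rainbow (k : nat) F : Prop :=
  #|F| = k /\ {in F &, forall e f, e != f -> nest e f}.

Definition endpoints F : {set V} := [set e.1 | e in F] :|: [set e.2 | e in F].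

Definition is_thick_twist (t k : nat) H : Prop :=
  exists R : 'I_k -> {set V * V},
    [/\ edges H = \bigcup_(i < k) R i,
        forall i, is_rainbow t (R i),
        forall i j, i != j -> [disjoint endpoints (R i) & endpoints (R j)]
      & forall i j, i != j -> {in R i & R j, forall e f, cross e f}].

Definition is_thick_rainbow (t k : nat) H : Prop :=
  exists R : 'I_k -> {set V * V},
    [/\ edges H = \bigcup_(i < k) R i,
        forall i, is_twist t (R i),
        forall i j, i != j -> [disjoint endpoints (R i) & endpoints (R j)]
      & forall i j, i != j -> {in R i & R j, forall e f, nest e f}].

Definition is_thick_pattern (k : nat) H : Prop :=
  is_thick_twist k k H \/ is_thick_rainbow k k H.

Definition matching G : Prop := forall u v w, adj G u v -> adj G u w -> v = w.

Definition bipartition G (V1 V2 : {set V}) : Prop :=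
  [/\ V1 :|: V2 = setT, [disjoint V1 & V2]
    & forall u v, adj G u v ->
        (u \in V1) && (v \in V2) || (u \in V2) && (v \in V1)].

Definition separated G (V1 V2 : {set V}) : Prop :=
  bipartition G V1 V2 /\ {in V1 & V2, forall x y, x < y}.

End OrderedGraphs.

Definition contains d d' (V : finOrderType d) (W : finOrderType d')
    (G : ograph V) (H : ograph W) : Prop :=
  exists f : W -> V,
    {homo f : x y / x < y} /\ (forall x y, adj H x y -> adj G (f x) (f y)).

(* The patterns are determined by their edges; isolated vertices of H, if any,
   play no role. *)
Definition contains_thick_pattern d (V : finOrderType d) (G : ograph V)
    (k : nat) : Prop :=
  exists (d' : Order.disp_t) (W : finOrderType d') (H : ograph W),
    is_thick_pattern k H /\ contains G H.

(* Main.v *)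
Require Import Defs.
From HB Require Import structures.
From mathcomp Require Import all_boot all_order all_algebra all_fingroup.
From mathcomp Require Import zify.
From Stdlib Require Import FunctionalExtensionality.

(* Map each edge of the separated matching to the point whose coordinates are
   the ranks of its two endpoints.  Crossing edges become increasing pairs and
   nesting edges decreasing pairs, so one has to cover a point set by few
   monotone sequences, and a thick twist is an increasing arrangement of
   decreasing sequences.

   Lower bound: in a k-thick twist, a stack meets at most one rainbow; either
   each of the k rainbows meets its own stack, or some rainbow is covered by
   queues, each containing at most one of its k edges.

   Upper bound, k >= 2: the level of a point is the largest number of decreasing
   (k+1)-sequences that can be piled up in its lower-left quadrant; it is at
   most k.  A level is a band between two descending staircases, and a
   lightning path cuts it into two families of cells running down to the right.
   In each cell either all lower-left or all upper-right quadrants of its points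
   are free of decreasing (k+1)-sequences.  In a family at most k cells contain
   an increasing (k+1)-sequence, for lack of thick rainbows, and by Mirsky's
   theorem the union of the others is covered by k decreasing sequences.
   Cutting a cell again after a reflection gives families of cells running up
   to the right; all cells of such a family except the last one lie in one
   quadrant, so k increasing sequences cover them.  In the last cell the two
   lower quadrants of its highest point are covered by k increasing and k
   decreasing sequences.  The total is polynomial of degree 4 in k.

   For k = 1 the crossing graph has no induced 2K_2, C_4 or C_5, hence it is a
   split graph. *)

Set Implicit Arguments.
Unset Strict Implicit.
Unset Printing Implicit Defensive.

Import Order.TTheory GRing.Theory Num.Theory.

(** * Cliques of a relation, covers by monotone sequences, and Mirsky's theorem *)

Section Cliques.
Variable T : finType.
Implicit Types (r : rel T) (A B C S : {set T}) (p q t : T).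

Definition clique r A := [forall p in A, forall q in A, (p != q) ==> r p q].

Lemma cliqueP r A :
  reflect {in A &, forall p q, p != q -> r p q} (clique r A).
Proof.
apply: (iffP idP) => [/forall_inP h p q pA qA|h].
  by move/forall_inP: (h p pA) => /(_ q qA) /implyP.
apply/forall_inP => p pA; apply/forall_inP => q qA; apply/implyP; exact: h.
Qed.

Definition nclique n r A := (#|A| == n) && clique r A.

Lemma cliqueS r A B : A \subset B -> clique r B -> clique r A.
Proof.
by move=> /subsetP sAB /cliqueP h; apply/cliqueP => p q /sAB pB /sAB; exact: h.
Qed.

Definition nclique_free n r S := forall B, B \subset S -> ~~ nclique n r B.

(** The members may overlap and reach outside [S]; they are made disjoint only when pages are
    formed. *)
Definition mono_cover (I D : rel T) m S :=
  exists F : seq {set T},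
    [/\ size F <= m, {in F, forall A, clique I A || clique D A} &
        {in S, forall p, exists2 A, A \in F & p \in A}].

Lemma mono_coverC I D m S : mono_cover I D m S -> mono_cover D I m S.
Proof. by case=> F [sF hF cF]; exists F; split=> // A /hF; rewrite orbC. Qed.

Lemma mono_coverS I D m m' S S' : m <= m' -> S' \subset S ->
  mono_cover I D m S -> mono_cover I D m' S'.
Proof.
move=> le_m /subsetP sS [F [sF hF cF]]; exists F; split=> //.
  exact: leq_trans le_m.
by move=> p /sS /cF.
Qed.

Lemma mono_cover0 I D : mono_cover I D 0 set0.
Proof. by exists [::]; split=> // p; rewrite inE. Qed.

Lemma mono_coverU I D m m' S S' :
  mono_cover I D m S -> mono_cover I D m' S' ->
  mono_cover I D (m + m') (S :|: S').
Proof.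
move=> [F [sF hF cF]] [F' [sF' hF' cF']]; exists (F ++ F'); split.
- by rewrite size_cat leq_add.
- by move=> A; rewrite mem_cat => /orP[/hF|/hF'].
- move=> p; rewrite inE => /orP[/cF|/cF'] [A AF pA]; exists A => //;
  by rewrite mem_cat AF ?orbT.
Qed.

Lemma mono_cover_bigU I D m (J : eqType) (s : seq J) (C : J -> {set T}) S :
  {in s, forall i, mono_cover I D m (C i)} ->
  {in S, forall p, exists2 i, i \in s & p \in C i} ->
  mono_cover I D (m * size s) S.
Proof.
elim: s S => [|i s IHs] S hC hS.
  apply: mono_coverS (mono_cover0 I D) => //.
  by apply/subsetP => p /hS [].
have := mono_coverU (hC i (mem_head _ _)) (IHs (S :\: C i) _ _).
rewrite /= mulnS => hU; apply: mono_coverS (hU _ _) => //.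
- by apply/subsetP => p pS; rewrite !inE pS; case: (p \in C i).
- by move=> i' i's; apply: hC; rewrite inE i's orbT.
- move=> p; rewrite inE => /andP[pNC /hS[i']]; rewrite inE => /predU1P[->|i's pC].
    by rewrite (negbTE pNC).
  by exists i'.
Qed.

(** Induction on [k]: the minimal elements of [S] form a clique of [D], and a chain of other
    elements can be lengthened downwards inside [S]. *)
Lemma mirsky (lt : rel T) (I D : rel T) k S :
  irreflexive lt -> transitive lt ->
  (forall p q, I p q = lt p q || lt q p) ->
  (forall p q, p != q -> I p q || D p q) ->
  nclique_free k.+1 I S -> mono_cover I D k S.
Proof.
move=> irr tr IE ID; elim: k S => [|k IHk] S hS.
  apply: mono_coverS (mono_cover0 I D) => //; apply/subsetP => p pS; exfalso.
  have := hS [set p]; rewrite sub1set /nclique cards1 eqxx => /(_ pS)/negP[].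
  by apply/cliqueP => a b /set1P-> /set1P->; rewrite eqxx.
pose mn := [set p in S | [forall q in S, ~~ lt q p]].
have c1 : mono_cover I D 1 mn.
  exists [:: mn]; split=> // [A|p pm]; last by exists mn; rewrite ?mem_seq1.
  rewrite mem_seq1 => /eqP->.
  apply/orP; right; apply/cliqueP => p q; rewrite !inE.
  move=> /andP[pS /forall_inP hp] /andP[qS /forall_inP hq] npq.
  by have := ID p q npq; rewrite IE (negbTE (hp q qS)) (negbTE (hq p pS)).
have sSm : S :\: mn \subset S by apply: subsetDl.
apply: (@mono_coverS _ _ (1 + k) _ (mn :|: S :\: mn)) => //.
  by apply/subsetP => p pS; rewrite !inE pS; case: [forall _ in _, _].
apply: mono_coverU c1 (IHk _ _) => B sB; apply/negP => /andP[/eqP cB /cliqueP clB].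
have [b0 b0B] : exists b, b \in B by apply/card_gt0P; rewrite cB.
(* The element of [B] with the fewest elements of [B] below it is the least of the chain. *)
pose ht p := #|[set q in B | lt q p]|.
case: (arg_minnP ht b0B) => b bB bmin.
have bS : b \in S :\: mn by apply: (subsetP sB).
have bB' q : q \in B -> q != b -> lt b q.
  move=> qB nqb; have := clB _ _ qB bB nqb; rewrite IE => /orP[ltqb|//].
  have := bmin q qB; rewrite leqNgt => /negP[]; apply: proper_card.
  apply/properP; split.
    apply/subsetP => a; rewrite !inE => /andP[-> ltaq]; exact: tr ltqb.
  by exists q; rewrite !inE ?irr ?andbF // qB.
move: bS; rewrite !inE => /andP[]; case bS: (b \in S) => //=.
move=> /forall_inPn[w wS] /negPn ltwb _.
have wB : w \notin B.
  apply/negP => wB; have [e|nwb] := eqVneq w b.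
    by move: ltwb; rewrite e irr.
  by have := tr _ _ _ ltwb (bB' w wB nwb); rewrite irr.
have ltwq q : q \in B -> lt w q.
  by move=> qB; have [->//|/(bB' _ qB)] := eqVneq q b; apply: tr.
suff: nclique k.+2 I (w |: B).
  by apply/negP/hS; rewrite subUset sub1set wS (subset_trans sB).
rewrite /nclique cardsU1 wB cB eqxx /=.
apply/cliqueP => p q /setU1P[->|pB] /setU1P[->|qB] npq.
- by rewrite eqxx in npq.
- by rewrite IE ltwq.
- by rewrite IE ltwq ?orbT.
- exact: clB.
Qed.

(** [c] names the cell of a point. Labels that do not occur give empty cells, so [P] has to hold for
    the empty set. *)
Definition cells (P : {set T} -> Prop) r S :=
  exists c : T -> nat,
    {in S &, forall p q, c p != c q -> r p q} /\
    forall i, P [set p in S | c p == i].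

(* For crossing [I] and nesting [D], or the other way round: there is no n-thick
   n-twist, resp. n-thick n-rainbow. *)
Definition thin (I D : rel T) n :=
  ~ exists R : 'I_n -> {set T},
      (forall i, nclique n D (R i)) /\
      (forall i j, i != j -> {in R i & R j, forall p q, I p q}).

(** Cells with a clique of [I] of size k+1 are few and cost [m] each; the other cells are covered
    together by Mirsky's theorem. *)
Lemma cells_cover (P : {set T} -> Prop) (lt I D : rel T) k m S :
  irreflexive lt -> transitive lt ->
  (forall p q, I p q = lt p q || lt q p) ->
  (forall p q, p != q -> I p q (+) D p q) ->
  thin D I k.+1 ->
  (forall C, C \subset S -> P C -> mono_cover I D m C) ->
  cells P D S -> mono_cover I D (k + m * k) S.
Proof.
move=> irr tr IE ID hthin hP [c [hc hcell]].
pose cell i := [set p in S | c p == i].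
pose big i := [exists B : {set T}, (B \subset cell i) && nclique k.+1 I B].
pose X := [set p in S | big (c p)].
pose s := undup [seq c p | p in X].
have sP i : i \in s -> big i.
  by rewrite mem_undup => /mapP[p]; rewrite mem_enum inE => /andP[_ h] ->.
(* One clique from each of k+1 big cells would form what [thin D I k.+1] excludes. *)
have size_s : size s <= k.
  rewrite leqNgt; apply/negP => lt_ks; apply: hthin.
  have sn (i : 'I_k.+1) : nth 0 s i \in s.
    by apply: mem_nth; apply: leq_trans (ltn_ord i) _.
  exists (fun i : 'I_k.+1 => odflt set0
      [pick B : {set T} | (B \subset cell (nth 0 s i)) && nclique k.+1 I B]).
  have pickB (i : 'I_k.+1) B0 : B0 = odflt set0
      [pick B : {set T} | (B \subset cell (nth 0 s i)) && nclique k.+1 I B] ->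
      (B0 \subset cell (nth 0 s i)) && nclique k.+1 I B0.
    case: pickP => [B /andP[h1 h2] -> /=|no _]; first by rewrite h1.
    by have /existsP[B] := sP _ (sn i); rewrite no.
  split=> [i|i j nij p q pB qB]; first by have /andP[] := pickB i _ erefl.
  have /andP[/subsetP sp _] := pickB i _ erefl.
  have /andP[/subsetP sq _] := pickB j _ erefl.
  have := sp _ pB; have := sq _ qB.
  rewrite !inE => /andP[qS /eqP cq] /andP[pS /eqP cp]; apply: hc => //.
  rewrite cp cq nth_uniq ?undup_uniq //;
    exact: leq_trans (ltn_ord _) _.
apply: (@mono_coverS _ _ (k + m * size s) _ ((S :\: X) :|: X)).
- by rewrite leq_add2l leq_mul2l size_s orbT.
- by apply/subsetP => p pS; rewrite !inE pS; case: (big _).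
apply: mono_coverU.
  (* A clique of [I] stays inside one cell, since different cells are related by [D]. *)
  apply: (mirsky irr tr IE) => [p q /ID|B sB]; first by case: (I p q).
  apply/negP => /andP[cB clB].
  have [p pB] : exists p, p \in B by apply/card_gt0P; rewrite (eqP cB).
  have := subsetP sB p pB; rewrite !inE => /andP[+ pS]; rewrite pS /= => /negP[].
  apply/existsP; exists B; rewrite /nclique cB clB !andbT.
  apply/subsetP => q qB; have := subsetP sB q qB; rewrite !inE => /andP[_ qS].
  rewrite qS /=; have [//|ncqp] := eqVneq (c q) (c p).
  have npq : q != p by apply: contraNneq ncqp => ->.
  have := hc _ _ qS pS ncqp; have := ID _ _ npq.
  by rewrite (cliqueP _ _ clB _ _ qB pB npq) /= => /negbTE->.
apply: (@mono_cover_bigU _ _ _ _ _ cell) => [i _|p pX].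
  by apply: hP (hcell i); apply/subsetP => p; rewrite inE => /andP[].
exists (c p); last by move: pX; rewrite !inE eqxx andbT => /andP[].
by rewrite mem_undup; apply: map_f; rewrite mem_enum.
Qed.

End Cliques.

(** * Point sets in the plane and their reflections *)

Section Plane.
Local Open Scope ring_scope.
Variable T : finType.
Implicit Types (x y : T -> int) (A B C S L U D : {set T}) (p q t : T).

Definition neg x : T -> int := fun p => - x p.
Definition below x y p q := (x p < x q) && (y p < y q).
Definition inc x y p q := below x y p q || below x y q p.
(** Written through [neg] so that facts about [inc] transfer by reflection. *)
Definition dec x y := inc (neg x) y.

Lemma negK x : neg (neg x) = x.
Proof. by apply: functional_extensionality => p; rewrite /neg opprK. Qed.

Lemma neg_inj x : injective x -> injective (neg x).
Proof. by move=> hx p q /oppr_inj /hx. Qed.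

Lemma incC x y : inc y x = inc x y.
Proof.
do 2!apply: functional_extensionality => ?.
by rewrite /inc /below andbC [X in _ || X]andbC.
Qed.

Lemma inc_neg2 x y : inc (neg x) (neg y) = inc x y.
Proof.
do 2!apply: functional_extensionality => ?; rewrite /inc /below /neg; lia.
Qed.

Lemma inc_negr x y : inc x (neg y) = dec x y.
Proof. by rewrite -inc_neg2 negK. Qed.

Lemma decN x y : dec (neg x) y = inc x y.
Proof. by rewrite /dec negK. Qed.

Lemma inc_dec x y p q :
  injective x -> injective y -> p != q -> inc x y p q (+) dec x y p q.
Proof.
move=> hx hy npq; rewrite /dec /inc /below /neg.
have := inj_eq hx p q; have := inj_eq hy p q; rewrite (negbTE npq); lia.
Qed.

Lemma below_irr x y : irreflexive (below x y).
Proof. by move=> p; rewrite /below ltxx. Qed.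

Lemma below_trans x y : transitive (below x y).
Proof. by move=> q p r; rewrite /below; lia. Qed.

(** * Levels of piled decreasing sequences, and the lightning path in a level *)

Section Band.
Variables (x y : T -> int) (k : nat).
Hypotheses (hx : injective x) (hy : injective y) (k_gt0 : (0 < k)%N).
Hypothesis hthin : thin (inc x y) (dec x y) k.+1.

(** [sw] and [ne] stand for the lower-left and upper-right quadrants. *)
Definition swfree C := forall p, p \in C ->
  nclique_free k.+1 (dec x y) [set q in C | below x y q p].

Definition nefree C := forall p, p \in C ->
  nclique_free k.+1 (dec x y) [set q in C | below x y p q].

(* Piles of [j] decreasing sequences inside [S], chosen from the top down. *)
Fixpoint stack j S : bool :=
  if j is j'.+1 then
    [exists B : {set T}, [&& B \subset S, nclique k.+1 (dec x y) B &
       stack j' [set q in S | [forall p in B, below x y q p]]]]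
  else true.

Lemma stackS j S S' : S \subset S' -> stack j S -> stack j S'.
Proof.
elim: j S S' => //= j IHj S S' sS /existsP[B /and3P[sB cB hB]].
apply/existsP; exists B; rewrite (subset_trans sB) // cB /=; apply: IHj hB.
by apply/subsetP => q; rewrite !inE => /andP[/(subsetP sS)-> ->].
Qed.

Lemma stack_family j S : stack j S -> exists R : nat -> {set T},
  [/\ forall i, (i < j)%N -> nclique k.+1 (dec x y) (R i),
      forall i, (i < j)%N -> R i \subset S &
      forall i i', (i < i' < j)%N -> {in R i & R i', forall p q, below x y p q}].
Proof.
elim: j S => [|j IHj] S; first by exists (fun=> set0); split=> // ? ? /andP[].
case/existsP=> B /and3P[sB cB /IHj[R [h1 h2 h3]]].
(* The family is listed from the bottom up, so the top sequence [B] gets the last index [j]. *)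
exists (fun i => if (i < j)%N then R i else B); split=> [i _|i _|i i'].
- by case: ifP => // /h1.
- by case: ifP => // /h2 /subset_trans; apply; apply/subsetP => q /[!inE]/andP[].
- rewrite ltnS => /andP[lt_ii' le_i'j]; rewrite (leq_trans lt_ii') //.
  case: ltnP => [lt_i'j|_] p q pR qR; first by apply: h3 pR qR; rewrite lt_ii'.
  have /h2/subsetP/(_ p pR) : (i < j)%N by apply: leq_trans lt_ii' _.
  by rewrite inE => /andP[_ /forall_inP]; apply.
Qed.

(** The first k+1 sequences of a higher pile would be a (k+1)-thick (k+1)-twist. *)
Lemma stack_lt j S : stack j S -> (j <= k)%N.
Proof.
move=> /stack_family[R [h1 h2 h3]]; rewrite leqNgt; apply/negP => lt_kj.
have ltj (i : 'I_k.+1) : (i < j)%N by apply: leq_trans (ltn_ord i) _.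
apply: hthin; exists (fun i => R i); split=> [i|i i' nii' p q pR qR].
  exact: h1.
have : (i < i')%N || (i' < i)%N by rewrite -neq_ltn.
rewrite /inc => /orP[lt_i|lt_i].
  by rewrite (h3 i i' _ p q pR qR) // lt_i ltj.
by rewrite (h3 i' i _ q p qR pR) ?orbT // lt_i ltj.
Qed.

(** The bounds are strict; over the integers, [x p + 1] and [y p + 1] give the closed quadrant of
    [p]. *)
Definition reach j (a b : int) := stack j [set q | (x q < a) && (y q < b)].

Lemma reachS j a b a' b' : a <= a' -> b <= b' -> reach j a b -> reach j a' b'.
Proof.
move=> la lb; apply: stackS; apply/subsetP => q; rewrite !inE; lia.
Qed.

(** [B] lies in the box between the corners (a, b) and (a', b'), hence above and to the right of the
    whole pile. *)
Lemma reach_next j a b a' b' B : nclique k.+1 (dec x y) B ->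
  {in B, forall q, [&& a <= x q, b <= y q, x q < a' & y q < b']} ->
  reach j a b -> reach j.+1 a' b'.
Proof.
move=> cB hB h; apply/existsP; exists B; apply/and3P; split=> //.
  by apply/subsetP => q /hB; rewrite inE => /and4P[_ _ -> ->].
have [p0 p0B] : exists b, b \in B.
  by apply/card_gt0P; have /andP[/eqP->] := cB.
apply: stackS h; apply/subsetP => q; rewrite !inE => hq.
apply/andP; split; first by have := hB _ p0B; lia.
by apply/forall_inP => p /hB; rewrite /below; lia.
Qed.

(* A decreasing sequence through [p] has no other point weakly below [p]. *)
Lemma reach_diag j p : reach j (x p + 1) (y p + 1) -> reach j (x p) (y p).
Proof.
case: j => // j /existsP[B /and3P[/subsetP sB cB h]].
have /andP[/eqP cardB /cliqueP clB] := cB.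
have pB : p \notin B.
  apply/negP => pB; have /card_gt0P[q] : (0 < #|B :\ p|)%N.
    by have := cardsD1 p B; rewrite pB cardB; lia.
  rewrite !inE => /andP[npq qB]; have := clB _ _ qB pB npq.
  by have := sB _ qB; rewrite inE /dec /inc /below /neg; lia.
have lt_B q : q \in B -> (x q < x p) && (y q < y p).
  move=> qB; have npq : q != p by apply: contraNneq pB => <-.
  have := inj_eq hx q p; have := inj_eq hy q p; rewrite (negbTE npq).
  by have := sB _ qB; rewrite inE; lia.
have [p0 p0B] : exists b, b \in B by apply/card_gt0P; rewrite cardB.
apply/existsP; exists B; rewrite cB /=; apply/andP; split.
  by apply/subsetP => q /lt_B; rewrite inE.
apply: stackS h; apply/subsetP => q; rewrite !inE => /andP[_ hq].
rewrite hq andbT; have := forall_inP hq _ p0B; have := lt_B _ p0B.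
by rewrite /below; lia.
Qed.

(** Open quadrant in the first condition, closed in the second; by [reach_diag] both have the same
    maximal pile. *)
Definition level j :=
  [set p | reach j (x p) (y p) && ~~ reach j.+1 (x p + 1) (y p + 1)].

Lemma levelP p : exists2 j, (j <= k)%N & p \in level j.
Proof.
have ex : exists j, reach j (x p) (y p) by exists 0%N.
case: (ex_maxnP ex (fun j => @stack_lt j _)) => j hj jmax.
exists j; first exact: stack_lt hj.
rewrite inE hj; apply/negP => /reach_diag /jmax; rewrite ltnn //.
Qed.

(** A decreasing (k+1)-sequence of [C] below [p] could be put on the pile found at the height of its
    lowest point, and [p] would have too high a level. *)
Lemma swfree_reach j a C : C \subset level j ->
  {in C, forall q, (a <= x q) && reach j a (y q)} -> swfree C.
Proof.
move=> sC hC p pC B /subsetP sB; apply/negP => cB.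
have [b0 b0B] : exists b, b \in B.
  by apply/card_gt0P; have /andP[/eqP->] := cB.
case: (arg_minP y b0B) => s sInB smin.
have BC q : q \in B -> (q \in C) && below x y q p by move/sB; rewrite inE.
have := subsetP sC p pC; rewrite inE => /andP[_ /negP[]].
have /andP[sC' _] := BC _ sInB; have /andP[_ hs] := hC _ sC'.
apply: reach_next cB _ hs => q qB.
have /andP[qC] := BC _ qB; have /andP[h _] := hC _ qC.
have := smin _ qB; rewrite /below; lia.
Qed.

(** A sequence of [C] above [p] could be put on the pile below [p], and its rightmost point would
    violate the hypothesis. *)
Lemma nefree_reach j b C : C \subset level j ->
  {in C, forall q, (y q < b) && ~~ reach j.+1 (x q + 1) b} -> nefree C.
Proof.
move=> sC hC p pC B /subsetP sB; apply/negP => cB.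
have [b0 b0B] : exists b, b \in B.
  by apply/card_gt0P; have /andP[/eqP->] := cB.
case: (arg_maxP x b0B) => s sInB smax.
have BC q : q \in B -> (q \in C) && below x y p q by move/sB; rewrite inE.
have /andP[sC' _] := BC _ sInB; have /andP[_ /negP[]] := hC _ sC'.
have := subsetP sC p pC; rewrite inE => /andP[hp _].
apply: reach_next cB _ hp => q qB.
have /andP[qC] := BC _ qB; have /andP[h _] := hC _ qC.
have := smax _ qB; rewrite /below; lia.
Qed.

Lemma cells_cons (P : {set T} -> Prop) A S (r : rel T) :
  (forall p q, r p q = r q p) -> [disjoint A & S] ->
  {in A & S, forall p q, r p q} -> P A -> cells P r S -> cells P r (A :|: S).
Proof.
move=> sym dAS hr hA [c [hc hP]].
have NA p : p \in S -> p \in A = false.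
  by move=> pS; apply: (disjointFl dAS).
exists (fun p => if p \in A then 0%N else (c p).+1); split=> [p q|[|i]].
- rewrite !inE; case pA: (p \in A); case qA: (q \in A) => //= pS qS.
  + by move=> _; apply: hr.
  + by move=> _; rewrite sym; apply: hr.
  + by rewrite eqSS; apply: hc.
- suff -> : [set p in A :|: S | (if p \in A then 0%N else (c p).+1) == 0%N] = A by [].
  by apply/setP => p; rewrite !inE; case: (p \in A); rewrite ?andbF.
- suff -> : [set p in A :|: S | (if p \in A then 0%N else (c p).+1) == i.+1]
     = [set p in S | c p == i] by [].
  apply/setP => p; rewrite !inE eq_sym; case pA: (p \in A) => /=.
    by case pS: (p \in S) => //; rewrite NA in pA.
  by rewrite eqSS eq_sym.
Qed.

(* The band [level j] is cut along a lightning path that alternately runs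
   right until it meets the upper boundary of the band and down until it meets
   the lower one; [D] collects the points below the path and [U] those above.
   The last condition is the invariant that keeps the cells of [U] apart. *)
Lemma zigzag j L : L \subset level j -> exists U D,
  [/\ L = U :|: D, cells swfree (dec x y) U, cells nefree (dec x y) D &
      {in U, forall p, exists2 t, t \in L & reach j.+1 (x p + 1) (y t + 1)}].
Proof.
have decC p q : dec x y p q = dec x y q p by rewrite /dec /inc orbC.
have dec_xy p q : x p < x q -> y q < y p -> dec x y p q.
  by rewrite /dec /inc /below /neg; lia.
have cells0 P : P set0 -> cells P (dec x y) set0.
  move=> hP; exists (fun=> 0%N); split=> [p|i]; first by rewrite inE.
  suff -> : [set p in set0 | 0%N == i] = set0 :> {set T} by [].
  by apply/setP => p; rewrite !inE.
have [m] := ubnP #|L|; elim: m L => // m IHm L; rewrite ltnS => cL sL.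
have [->|[t0 t0L]] := set_0Vmem L.
  exists set0, set0; rewrite setU0; split=> // [| |p]; last by rewrite inE.
  - by apply: cells0 => p; rewrite inE.
  - by apply: cells0 => p; rewrite inE.
case: (arg_maxP y t0L) => t tL tmax.
have lev p : p \in L -> reach j (x p) (y p) /\ ~~ reach j.+1 (x p + 1) (y p + 1).
  by move/(subsetP sL); rewrite inE => /andP[].
(* The path runs right at the height of the top point [t] until it meets the upper boundary; [D1] is
   the cell below this run. *)
pose D1 := [set p in L | ~~ reach j.+1 (x p + 1) (y t + 1)].
have tD1 : t \in D1 by rewrite inE; have [_ ->] := lev t tL; rewrite andbT.
have ne1 : nefree D1.
  apply: (@nefree_reach j (y t + 1)); first by apply: subset_trans sL;
    apply/subsetP => p /[!inE]/andP[].
  move=> q; rewrite inE => /andP[qL ->]; rewrite andbT.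
  by have := tmax _ qL; lia.
have [R00|[q0 q0R]] := set_0Vmem (L :\: D1).
  exists set0, D1; split=> [| | |p]; last by rewrite inE.
  - rewrite set0U; apply/eqP; rewrite eqEsubset -setD_eq0 R00 eqxx /=.
    by apply/subsetP => p; rewrite inE => /andP[].
  - by apply: cells0 => p; rewrite inE.
  - rewrite -[D1]setU0; apply: cells_cons => //; last by apply: cells0 => p; rewrite inE.
    + by rewrite disjoint_sym disjoints_subset sub0set.
    + by move=> p q _; rewrite inE.
case: (arg_minP x q0R) => q qR qmin.
have RP p : p \in L :\: D1 -> p \in L /\ reach j.+1 (x p + 1) (y t + 1).
  rewrite !inE => /andP[+ pL]; rewrite pL /= negbK; by [].
(* From the leftmost remaining point [q] the path goes down to the lower boundary; [U1] is the cell
   to the right of this descent. *)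
pose U1 := [set p in L :\: D1 | reach j (x q) (y p)].
pose R := (L :\: D1) :\: U1.
have sRL : R \subset L.
  by apply/subsetP => p; rewrite !inE => /and3P[].
have RE p : p \in R -> [/\ p \in L :\: D1, p \in L & ~~ reach j (x q) (y p)].
  rewrite inE => /andP[h1 h2]; split=> //; first exact: (subsetP (subsetDl _ _) _ h2).
  by move: h1; rewrite inE h2.
have sw1 : swfree U1.
  apply: (@swfree_reach j (x q)).
    apply: subset_trans sL; apply/subsetP => p; rewrite inE => /andP[h _].
    exact: (subsetP (subsetDl _ _) _ h).
  move=> p; rewrite inE => /andP[h ->]; rewrite andbT; exact: qmin.
have cR : (#|R| < m)%N.
  apply: leq_trans cL; apply: proper_card; apply/properP; split=> //.
  by exists t => //; rewrite 3!inE tD1 andbF.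
have [U [D [RUD cU cD inv]]] := IHm R cR (subset_trans sRL sL).
have sUR : {subset U <= R} by move=> p; rewrite RUD inE => ->.
have sDR : {subset D <= R} by move=> p; rewrite RUD inE orbC => ->.
exists (U1 :|: U), (D1 :|: D); split.
- rewrite setUACA -RUD; apply/setP => p; rewrite !inE.
  by case: (p \in L) => //=; case: (reach j.+1 _ _); case: (reach j _ _).
- apply: cells_cons cU => // [|p r pU rU].
    rewrite disjoint_sym disjoints_subset; apply/subsetP => p /sUR.
    by rewrite inE in_setC => /andP[].
  have /RE[rR rL nr] := sUR _ rU.
  have := pU; rewrite inE => /andP[pR hp]; have [pL _] := RP _ pR.
  have lt_y : y r < y p.
    by rewrite ltNge; apply: contra nr => le; apply: reachS hp.
  (* If [r] were not to the right of [p], the invariant would give a pile of [j.+1] sequences in the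
     closed quadrant of [p]. *)
  apply: dec_xy => //; rewrite ltNge; apply/negP => le_x.
  have [s /RE[_ sL' ns] hs] := inv _ rU.
  have lt_ys : y s < y p.
    by rewrite ltNge; apply: contra ns => le; apply: reachS hp.
  have [_ /negP[]] := lev _ pL; apply: reachS hs; rewrite lerD2r //; exact: ltW.
- apply: cells_cons cD => // [|p r pD rD].
    rewrite disjoint_sym disjoints_subset; apply/subsetP => p /sDR /RE[].
    by rewrite inE in_setC => /andP[].
  have /RE[rR rL nr] := sDR _ rD; have [_ hr] := RP _ rR.
  have := pD; rewrite inE => /andP[pL np]; have [hp _] := lev _ pL.
  have ltx s : s \in L :\: D1 -> x p < x s.
    move=> /RP[_ hs]; rewrite ltNge; apply: contra np => le.
    by apply: reachS hs; rewrite lerD2r.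
  apply: dec_xy; first exact: ltx.
  rewrite ltNge; apply: contra nr => le.
  by apply: reachS hp => //; apply/ltW/ltx.
- move=> p; rewrite inE => /orP[|/inv[s sR hs]].
    by rewrite inE => /andP[/RP[_ h] _]; exists t.
  by exists s => //; apply: (subsetP sRL).
Qed.

Lemma swfreeS C C' : C' \subset C -> swfree C -> swfree C'.
Proof.
move=> /subsetP sC hC p pC B sB; apply: (hC p (sC _ pC)).
apply: subset_trans sB _; apply/subsetP => q.
by rewrite !inE => /andP[/sC-> ->].
Qed.

(** Level 0 has empty piles, so it is [swfree]; level [k] is [nefree], as no pile has k+1 sequences.
    Each of the k-1 levels between them is cut by [zigzag] into two families. *)
Lemma band_cover (I D : rel T) m1 m2 S :
  (forall C, C \subset S -> swfree C -> mono_cover I D m1 C) ->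
  (forall C, C \subset S -> nefree C -> mono_cover I D m1 C) ->
  (forall U, U \subset S -> cells swfree (dec x y) U -> mono_cover I D m2 U) ->
  (forall U, U \subset S -> cells nefree (dec x y) U -> mono_cover I D m2 U) ->
  mono_cover I D (m1 + m1 + (m2 + m2) * k.-1) S.
Proof.
move=> h1 h2 h3 h4.
have s0 : S :&: level 0 \subset S by apply: subsetIl.
have c0 : mono_cover I D m1 (S :&: level 0).
  apply: (h1 _ s0) => p pC B sB; apply/negP => cB.
  have := subsetP (subsetIr _ _) _ pC; rewrite inE => /andP[_ /negP[]].
  apply: stackS (_ : stack 1 B); last first.
    by apply/existsP; exists B; rewrite subxx cB.
  apply/subsetP => q /(subsetP sB); rewrite !inE /below; lia.
have ck : mono_cover I D m1 (S :&: level k).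
  apply: (h2 _ (subsetIl _ _)) => p pC B sB; apply/negP => cB.
  have := subsetP (subsetIr _ _) _ pC; rewrite inE => /andP[hp _].
  have : stack k.+1 setT.
    apply/existsP; exists B; rewrite subsetT cB /=.
    apply: stackS hp; apply/subsetP => q; rewrite !inE => hq.
    apply/forall_inP => r /(subsetP sB); rewrite !inE /below; lia.
  by move/stack_lt; rewrite ltnn.
have cmid : mono_cover I D ((m2 + m2) * size (iota 1 k.-1))
    [set p in S | has (fun j => p \in level j) (iota 1 k.-1)].
  apply: (@mono_cover_bigU _ _ _ _ _ _ (fun j => S :&: level j)) => [j _|p].
    have [U [E [eqUE cU cE _]]] := zigzag (subsetIr S (level j)).
    have sUE : U :|: E \subset S by rewrite -eqUE subsetIl.
    rewrite eqUE; apply: mono_coverU; [apply: h3|apply: h4] => //.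
      exact: subset_trans (subsetUl _ _) sUE.
    exact: subset_trans (subsetUr _ _) sUE.
  rewrite inE => /andP[pS /hasP[j js pj]].
  by exists j => //; rewrite inE pS.
rewrite size_iota in cmid.
apply: mono_coverS (mono_coverU (mono_coverU c0 ck) cmid) => //.
apply/subsetP => p pS; have [j le_jk pj] := levelP p.
rewrite !(in_setU, in_setI) pS /= inE pS /=.
case: (posnP j) pj => [->->//|j_gt0].
have [->->|nej] := eqVneq j k; first by rewrite orbT.
move=> pj; apply/orP; right; apply/hasP; exists j => //.
by rewrite mem_iota; lia.
Qed.

End Band.
End Plane.

(** * The second cut, after a reflection, and the number of sequences used *)

Section Costs.
Local Open Scope ring_scope.
Variables (T : finType) (k : nat).
Hypothesis k_gt0 : (0 < k)%N.
Implicit Types (x y : T -> int) (B C S U : {set T}) (p q t : T).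

Lemma decC x y : dec y x = dec x y.
Proof. by rewrite -[RHS]inc_negr incC. Qed.

Lemma dec_neg2 x y : dec (neg x) (neg y) = dec x y.
Proof. by rewrite /dec inc_neg2. Qed.

Lemma swfreeC x y C : swfree x y k C -> swfree y x k C.
Proof.
move=> hC p pC B sB; rewrite decC; apply: (hC p pC).
apply: subset_trans sB _; apply/subsetP => q.
by rewrite !inE /below [(y q < _) && _]andbC.
Qed.

Lemma nefree_neg x y C : nefree (neg x) (neg y) k C -> swfree x y k C.
Proof.
move=> hC p pC B sB; rewrite -dec_neg2; apply: (hC p pC).
apply: subset_trans sB _; apply/subsetP => q.
by rewrite !inE /below /neg !ltrN2.
Qed.

Lemma nefreeE x y C : nefree x y k C -> swfree (neg x) (neg y) k C.
Proof. by rewrite -{1}[x]negK -{1}[y]negK => /nefree_neg. Qed.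

Lemma cells_impl (P P' : {set T} -> Prop) (r : rel T) S :
  (forall C, P C -> P' C) -> cells P r S -> cells P' r S.
Proof. by move=> PP' [c [h1 h2]]; exists c; split=> // i; apply/PP'/h2. Qed.

Lemma inc_free_cover x y S : injective x -> injective y ->
  nclique_free k.+1 (inc x y) S -> mono_cover (inc x y) (dec x y) k S.
Proof.
move=> hx hy; apply: (@mirsky _ (below x y)) => //.
- exact: below_irr.
- exact: below_trans.
- by move=> p q npq; have := inc_dec hx hy npq; case: inc.
Qed.

Lemma dec_free_cover x y S : injective x -> injective y ->
  nclique_free k.+1 (dec x y) S -> mono_cover (inc x y) (dec x y) k S.
Proof.
move=> hx hy hS; apply: mono_coverC; rewrite -[inc x y]decN.
exact: inc_free_cover (neg_inj hx) hy hS.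
Qed.

(** All points lie in the two lower quadrants of the highest point; one has no long decreasing
    sequence, the other no long increasing one. *)
Lemma swfree_both_cover x y C : injective x -> injective y ->
  swfree x y k C -> swfree (neg x) y k C ->
  mono_cover (inc x y) (dec x y) (k + k) C.
Proof.
move=> hx hy sw se; have [->|[t0 t0C]] := set_0Vmem C.
  exact: mono_coverS (mono_cover0 _ _).
case: (arg_maxP y t0C) => t tC tmax.
pose W := [set q in C | below x y q t]; pose E := [set q in C | below (neg x) y q t].
have cW : mono_cover (inc x y) (dec x y) k (t |: W).
  apply: dec_free_cover => // B sB; apply/negP => cB.
  have /andP[/eqP cardB /cliqueP clB] := cB.
  suff tB : t \notin B.
    refine (negP (sw t tC B _) cB).
    apply/subsetP => q qB; have := subsetP sB q qB.
    by rewrite in_setU1 => /predU1P[eqt|//]; rewrite -eqt qB in tB.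
  (* [t] forms increasing pairs with all of [W], so it is in no decreasing sequence of two or more
     points of [t |: W]. *)
  apply/negP => tB; have /card_gt0P[q] : (0 < #|B :\ t|)%N.
    by have := cardsD1 t B; rewrite tB cardB; lia.
  rewrite !inE => /andP[nqt qB]; have := clB _ _ qB tB nqt.
  have := subsetP sB q qB; rewrite !inE (negbTE nqt) /= => /andP[_].
  by rewrite /dec /inc /below /neg; lia.
have cE : mono_cover (inc x y) (dec x y) k E.
  by apply: inc_free_cover => // B sB; rewrite -decN; apply: se tC _ sB.
apply: mono_coverS (mono_coverU cW cE) => //; apply/subsetP => q qC.
rewrite !inE qC /=; have [//|nqt] := eqVneq q t.
have := inj_eq hx q t; have := inj_eq hy q t; rewrite (negbTE nqt).
by have := tmax _ qC; rewrite /below /neg; lia.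
Qed.

(** The cell of the highest point [t] is covered by [swfree_both_cover]; all other cells lie to the
    lower left of [t]. *)
Lemma swfree_cells_cover x y C U : injective x -> injective y ->
  swfree x y k C -> U \subset C -> cells (swfree (neg x) y k) (inc x y) U ->
  mono_cover (inc x y) (dec x y) (k + k + k) U.
Proof.
move=> hx hy sw sU [c [hc hP]]; have [->|[t0 t0U]] := set_0Vmem U.
  exact: mono_coverS (mono_cover0 _ _).
case: (arg_maxP y t0U) => t tU tmax.
have c1 : mono_cover (inc x y) (dec x y) (k + k) [set q in U | c q == c t].
  apply: swfree_both_cover => //; apply: swfreeS sw.
  by apply: subset_trans sU; apply/subsetP => q; rewrite inE => /andP[].
have c2 : mono_cover (inc x y) (dec x y) k [set q in U | c q != c t].
  apply: dec_free_cover => // B sB; apply: sw (subsetP sU _ tU) _ _.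
  apply: subset_trans sB _; apply/subsetP => q; rewrite !inE => /andP[qU nc].
  rewrite (subsetP sU _ qU); have := hc _ _ qU tU nc; have := tmax _ qU.
  by rewrite /inc /below; lia.
apply: mono_coverS (mono_coverU c1 c2) => //.
by apply/subsetP => q qU; rewrite !inE qU; case: eqP.
Qed.

(** The bound of [band_cover] for m1 = 2k and m2 = 3k. *)
Definition cell_cost := (k + k + (k + k) + (k + k + k + (k + k + k)) * k.-1)%N.

Lemma swfree_cover x y C : injective x -> injective y ->
  thin (dec x y) (inc x y) k.+1 -> swfree x y k C ->
  mono_cover (inc x y) (dec x y) cell_cost C.
Proof.
move=> hx hy hthin sw.
have thin' : thin (inc (neg x) y) (dec (neg x) y) k.+1 by rewrite decN.
have swC := swfreeC sw.
(* Exchanging the coordinates turns upper-left quadrants into lower-right ones, so both kinds of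
   cells are treated alike. *)
have neE C' : nefree (neg x) y k C' -> swfree (neg y) x k C'.
  by move/nefreeE; rewrite negK => /swfreeC.
apply: (band_cover (neg_inj hx) hy k_gt0 thin') => C' sC'.
- by move=> sw'; apply: swfree_both_cover => //; apply: swfreeS sw.
- move=> /neE sw'; rewrite -(incC x y) -(decC x y).
  by apply: swfree_both_cover => //; apply: swfreeS swC.
- by rewrite decN => cl; apply: swfree_cells_cover sw sC' cl.
- rewrite decN -(incC x y) -(decC x y) => /(cells_impl neE) cl.
  exact: swfree_cells_cover swC sC' cl.
Qed.

Definition total_cost :=
  (cell_cost + cell_cost + (k + cell_cost * k + (k + cell_cost * k)) * k.-1)%N.

Lemma thin_cover x y S : injective x -> injective y ->
  thin (inc x y) (dec x y) k.+1 -> thin (dec x y) (inc x y) k.+1 ->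
  mono_cover (inc x y) (dec x y) total_cost S.
Proof.
move=> hx hy thin1 thin2.
have hsw C : swfree x y k C -> mono_cover (inc x y) (dec x y) cell_cost C.
  exact: swfree_cover.
(* A half-turn exchanges the two quadrants and preserves [inc] and [dec]. *)
have hne C : nefree x y k C -> mono_cover (inc x y) (dec x y) cell_cost C.
  move/nefreeE; rewrite -(inc_neg2 x y) -(dec_neg2 x y).
  apply: swfree_cover; [exact: neg_inj|exact: neg_inj|].
  by rewrite inc_neg2 dec_neg2.
have hcells (P : {set T} -> Prop) U :
    (forall C, P C -> mono_cover (inc x y) (dec x y) cell_cost C) ->
    cells P (dec x y) U ->
    mono_cover (inc x y) (dec x y) (k + cell_cost * k) U.
  move=> hP; apply: (@cells_cover _ _ (below x y)) => //.
  - exact: below_irr.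
  - exact: below_trans.
  - by move=> p q; apply: inc_dec.
  - by move=> C _; apply: hP.
apply: (band_cover hx hy k_gt0 thin1) => C _.
- exact: hsw.
- exact: hne.
- exact: (hcells _ C hsw).
- exact: (hcells _ C hne).
Qed.

End Costs.

(** At k = 1 the cost is 8 and exceeds 2, which is why that case is treated apart. *)
Lemma total_cost_le k : 1 < k -> total_cost k <= 2 * k ^ 7.
Proof.
case: k => [|[|k]] // _; rewrite /total_cost /cell_cost /= !expnS expn0; nia.
Qed.

(** * Split graphs and the case k = 1 *)

Section Split.
Variable T : finType.
Implicit Types (I D lt : rel T) (K : {set T}).

Lemma clique2 I a b : symmetric I -> I a b -> clique I [set a; b].
Proof.
move=> sym Iab; apply/cliqueP => p q /set2P[]-> /set2P[]->; rewrite ?eqxx //.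
by rewrite sym.
Qed.

(** Excludes an induced C_4 in the graph of [I] and, with [I] and [D] exchanged, an induced 2K_2. *)
Lemma thin2 I D a a' b b' : symmetric I -> symmetric D -> thin I D 2 ->
  a != a' -> b != b' -> D a a' -> D b b' ->
  I a b -> I a b' -> I a' b -> I a' b' -> False.
Proof.
move=> symI symD h na nb Da Db I1 I2 I3 I4; apply: h.
exists (fun i : 'I_2 => if i == ord0 then [set a; a'] else [set b; b']); split.
  by move=> i; case: ifP => _; rewrite /nclique cards2 ?na ?nb clique2.
move=> i j; case: ifP => i0; case: ifP => j0 nij p q.
- by rewrite (eqP i0) (eqP j0) in nij.
- by move=> /set2P[]-> /set2P[]->.
- by move=> /set2P[]-> /set2P[]->; rewrite symI.
- case/eqP: nij; apply: ord_inj; move: i0 j0; rewrite -!val_eqE /=.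
  have := ltn_ord i; have := ltn_ord j; lia.
Qed.

(** By transitivity the orientation alternates along an induced cycle, which is impossible for odd
    length. *)
Lemma comparability_noC5 lt I a b c d e : transitive lt ->
  (forall p q, I p q = lt p q || lt q p) ->
  I a b -> I b c -> I c d -> I d e -> I e a ->
  ~~ I a c -> ~~ I b d -> ~~ I c e -> ~~ I d a -> ~~ I e b -> False.
Proof.
move=> tr IE ab bc cd de ea ac bd ce da eb.
have alt p q r : I p q -> I q r -> ~~ I p r -> lt p q = ~~ lt q r.
  rewrite !IE negb_or => + + /andP[npr nrp].
  have [ltpq _ _|nltpq /= ltqp] := boolP (lt p q).
    by apply/esym/negP => ltqr; rewrite (tr q) in npr.
  have [//|nltqr /= ltrq] := boolP (lt q r).
  by rewrite (tr q) in nrp.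
have := alt _ _ _ ab bc ac; rewrite (alt _ _ _ bc cd bd) (alt _ _ _ cd de ce).
by rewrite (alt _ _ _ de ea da) (alt _ _ _ ea ab eb) !negbK; case: (lt a b).
Qed.

(* Take a maximum clique with the fewest edges outside it. *)
Lemma split_cover lt I D : irreflexive lt -> transitive lt ->
  (forall p q, I p q = lt p q || lt q p) -> symmetric D ->
  (forall p q, p != q -> I p q (+) D p q) ->
  thin I D 2 -> thin D I 2 -> mono_cover I D 2 setT.
Proof.
move=> irr tr IE symD ID thin1 thin2'.
have symI : symmetric I by move=> p q; rewrite !IE orbC.
have irrI p : I p p = false by rewrite IE irr.
have neI p q : I p q -> p != q by apply: contraTneq => ->; rewrite irrI.
have nID p q : p != q -> ~~ I p q -> D p q.
  by move=> /ID; case: (I p q).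
have noC4 a b c d : a != c -> b != d -> I a b -> I b c -> I c d -> I d a ->
    ~~ I a c -> ~~ I b d -> False.
  move=> nac nbd ab bc cd da ac bd.
  apply: (thin2 symI symD thin1 nac nbd (nID _ _ nac ac) (nID _ _ nbd bd)) => //.
  - by rewrite symI.
  - by rewrite symI.
have no2K2 a b c d : I a b -> I c d ->
    ~~ I a c -> ~~ I a d -> ~~ I b c -> ~~ I b d -> False.
  move=> ab cd ac ad bc bd.
  have nac : a != c by apply: contraNneq ad => ->.
  have nad : a != d by apply: contraNneq ac => ->; rewrite symI.
  have nbc : b != c by apply: contraNneq bd => ->.
  have nbd : b != d by apply: contraNneq bc => ->; rewrite symI.
  by apply: (thin2 symD symI thin2' (neI _ _ ab) (neI _ _ cd) ab cd); apply: nID.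
pose E K := [set e : T * T | [&& e.1 \notin K, e.2 \notin K & I e.1 e.2]].
pose N := #|{: T * T}|.
have leEN K : #|E K| <= N by apply: max_card.
have c0 : clique I set0 by apply/cliqueP => p q; rewrite inE.
(* The factor [N.+1] lets the size dominate; the other term favours few outside edges. *)
case: (arg_maxnP (fun K => #|K| * N.+1 + (N - #|E K|)) c0) => K cK Kmax.
have M1 K' : clique I K' -> #|K'| <= #|K|.
  move=> /Kmax /=; have := leEN K; have := leEN K'.
  move: #|E K| #|E K'| #|K| #|K'| (N) => a b c d m *; nia.
have M2 K' : clique I K' -> #|K'| = #|K| -> #|E K| <= #|E K'|.
  move=> /Kmax /= + eqK; rewrite eqK; have := leEN K; have := leEN K'.
  by move: #|E K| #|E K'| (#|K| * N.+1) (N) => a b c m *; lia.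
have clU K' p : clique I K' -> {in K', forall q, I p q} -> clique I (p |: K').
  move=> /cliqueP h hp; apply/cliqueP => a b /setU1P[->|aK] /setU1P[->|bK] nab.
  - by rewrite eqxx in nab.
  - exact: hp.
  - by rewrite symI; apply: hp.
  - exact: h.
exists [:: K; ~: K]; split=> // [A|p _]; last first.
  have [pK|pK] := boolP (p \in K); first by exists K; rewrite ?mem_head.
  by exists (~: K); rewrite !inE ?pK // eqxx orbT.
rewrite !inE => /orP[/eqP->|/eqP->]; first by rewrite cK.
apply/orP; right; apply/cliqueP => x0 y0; rewrite !inE => x0K y0K nxy0.
apply: nID => //; apply/negP => Ixy0.
pose nb u := [set z in K | ~~ I u z].
(* The sets of non-neighbours in [K] of the two ends are nested, or else there is an induced C_4. *)
have [x [y [xK yK Ixy snb]]] : exists x y,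
    [/\ x \notin K, y \notin K, I x y & nb x \subset nb y].
  have [h|/subsetPn[z]] := boolP (nb x0 \subset nb y0); first by exists x0, y0.
  rewrite inE => /andP[zK nxz]; rewrite inE zK /= negbK => yz.
  have [h|/subsetPn[w]] := boolP (nb y0 \subset nb x0).
    by exists y0, x0; split; rewrite // symI.
  rewrite inE => /andP[wK nyw]; rewrite inE wK /= negbK => xw.
  have nzw : z != w by apply: contraNneq nyw => <-.
  have := cliqueP _ _ cK _ _ zK wK nzw => zw; exfalso.
  apply: (noC4 x0 y0 z w) => //; last by rewrite symI.
  - by apply: contraNneq x0K => ->.
  - by apply: contraNneq y0K => ->.
have nbP u z : (z \in nb u) = (z \in K) && ~~ I u z by rewrite inE.
have [z zx] : exists z, z \in nb x.
  apply/set0Pn/negP => /eqP nb0; have := M1 (x |: K).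
  rewrite cardsU1 xK add1n ltnn; suff -> : clique I (x |: K) by move/(_ isT).
  apply: clU => // q qK; apply/negPn/negP => nI.
  by have := in_set0 q; rewrite -nb0 nbP qK nI.
have zy := subsetP snb z zx.
have /andP[zK nxz] : (z \in K) && ~~ I x z by rewrite -nbP.
have /andP[_ nyz] : (z \in K) && ~~ I y z by rewrite -nbP.
(* A second non-neighbour of [x] would also be one of [y] and give an induced 2K_2. So [x] can
   replace [z] in [K]. *)
have Ix q : q \in K -> q != z -> I x q.
  move=> qK nqz; apply/negPn/negP => nxq.
  have qy : q \in nb y by apply: (subsetP snb); rewrite nbP qK nxq.
  move: qy; rewrite nbP => /andP[_ nyq].
  exact: no2K2 Ixy (cliqueP _ _ cK _ _ qK zK nqz) nxq nxz nyq nyz.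
have cKz : clique I (K :\ z) by apply: cliqueS cK; apply: subsetDl.
pose K' := x |: K :\ z.
have cK' : clique I K' by apply: clU => // q /setD1P[nqz qK]; apply: Ix.
have xK' : x \notin K :\ z by rewrite !inE (negbTE xK) andbF.
have card_K' : #|K'| = #|K| by rewrite cardsU1 xK' (cardsD1 z K) zK.
(* Otherwise [K'] together with [y] would be a larger clique. *)
have [w [wK nwz nyw]] : exists w, [/\ w \in K, w != z & ~~ I y w].
  have [|h] := boolP [exists w, [&& w \in K, w != z & ~~ I y w]].
    by case/existsP=> w /and3P[]; exists w.
  have yK' : y \notin K'.
    by rewrite !inE (negbTE yK) andbF orbF eq_sym neI.
  have := M1 (y |: K'); rewrite cardsU1 yK' card_K' add1n ltnn.
  suff -> : clique I (y |: K') by move/(_ isT).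
  apply: clU => // q /setU1P[->|/setD1P[nqz qK]]; first by rewrite symI.
  apply/negPn/negP => nyq; case/negP: h; apply/existsP; exists q.
  by rewrite qK nqz.
have Ixw := Ix w wK nwz; have Iwz := cliqueP _ _ cK _ _ wK zK nwz.
have nxz' : x != z by apply: contraNneq xK => ->.
(* Otherwise exchanging [x] and [z] maps the edges outside [K'] injectively to edges outside [K] and
   misses [(x, y)], against the choice of [K]. *)
have [v [vK nvx Ivz nIvx]] :
    exists v, [/\ v \notin K, v != x, I v z & ~~ I v x].
  have [|h] := boolP [exists v, [&& v \notin K, v != x, I v z & ~~ I v x]].
    by case/existsP=> v /and4P[]; exists v.
  have hv v : v \notin K -> v != x -> I v z -> I v x.
    move=> vK nvx Ivz; apply/negPn/negP => nI; case/negP: h; apply/existsP.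
    by exists v; rewrite vK nvx Ivz.
  have := M2 K' cK' card_K'; rewrite leqNgt => /negP[].
  pose f := tperm x z.
  rewrite -(card_imset _ (f := fun e : T * T => (f e.1, f e.2))); last first.
    by move=> [a b] [c d] [/perm_inj-> /perm_inj->].
  apply: proper_card; apply/properP; split; last first.
    exists (x, y); first by rewrite inE /= xK yK.
    apply/negP => /imsetP[[a b]]; rewrite inE /= => /and3P[_ _ Iab] [ea eb].
    have ea' : a = z by apply: (@perm_inj _ f); rewrite -ea tpermR.
    have eb' : b = y.
      apply: (@perm_inj _ f); rewrite -eb tpermD ?(neI _ _ Ixy) //.
      by apply: contraNneq yK => <-.
    by rewrite ea' eb' symI (negbTE nyz) in Iab.
  have outE a : a \notin K' -> a = z \/ [/\ a \notin K, a != x & a != z].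
    rewrite !inE negb_or negb_and negbK => /andP[nax /orP[/eqP->|aK]]; first by left.
    by right; split=> //; apply: contraNneq aK => ->.
  apply/subsetP => _ /imsetP[[a b] + ->]; rewrite inE /= => /and3P[+ + Iab].
  rewrite [_ \in E K]inE /= /f => /outE[ea|[aK nax naz]] /outE[eb|[bK nbx nbz]].
  - by rewrite ea eb irrI in Iab.
  - rewrite ea tpermR tpermD 1?eq_sym // xK bK symI hv // symI -ea //.
  - by rewrite eb tpermR tpermD 1?eq_sym // xK aK hv // -eb.
  - by rewrite !tpermD 1?eq_sym // aK bK.
(* The adjacency of [v] to [y] and [w] decides between an induced 2K_2, C_4 and C_5. *)
have [Ivy|nvy] := boolP (I v y); last first.
  by apply: (no2K2 x y v z) => //; rewrite symI.
have nyw' : y != w by apply: contraNneq yK => ->.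
have [Ivw|nvw] := boolP (I v w).
  apply: (noC4 v y x w) => //; by rewrite symI.
by apply: (comparability_noC5 (a := v) (b := y) (c := x) (d := w) (e := z) tr IE);
   rewrite // symI.
Qed.

End Split.

(** * The lower bound: a thick pattern forces many pages *)

Lemma thick_le_blocks (E : finType) (k : nat) (A B : {set {set E}})
    (r1 r2 : rel E) (R : 'I_k -> {set E}) :
  (forall i, #|R i| = k) ->
  (forall i, {in R i &, forall e f, e != f -> r2 e f}) ->
  (forall i j, i != j -> {in R i & R j, forall e f, r1 e f}) ->
  (forall S : {set E}, S \in A -> {in S &, forall e f, ~~ r1 e f}) ->
  (forall S : {set E}, S \in B -> {in S &, forall e f, ~~ r2 e f}) ->
  (forall i, {in R i, forall e, exists2 S, S \in A :|: B & e \in S}) ->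
  k <= #|A| \/ k <= #|B|.
Proof.
move=> cR h2 h1 hA hB hAB.
have [/forallP hR|/forallPn[i /exists_inPn hi]] :=
    boolP [forall i, [exists S in A, ~~ [disjoint R i & S]]].
  (* No block of [A] meets two of the sets [R i], as [r1] holds between them. *)
  left; pose g i := odflt set0 [pick S in A | ~~ [disjoint R i & S]].
  have gP i : g i \in A /\ exists2 e, e \in R i & e \in g i.
    rewrite /g; case: pickP => [S /andP[SA /pred0Pn[e /andP[eR eS]]]|no].
      by split=> //; exists e.
    by have /exists_inP[S SA nd] := hR i; have := no S; rewrite SA nd.
  have g_inj : injective g.
    move=> i j eqg; apply/eqP/negPn/negP => nij.
    have [gA [e eR eg]] := gP i; have [_ [f fR fg]] := gP j.
    rewrite -eqg in fg; have := hA _ gA _ _ eg fg.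
    by rewrite (h1 _ _ nij _ _ eR fR).
  rewrite -[leqLHS]card_ord -cardsT -(card_imset _ g_inj).
  by apply: subset_leq_card; apply/subsetP => _ /imsetP[i _ ->]; case: (gP i).
(* [R i] avoids all blocks of [A], and its elements need distinct blocks of [B]. *)
right; pose g e := odflt set0 [pick S in B | e \in S].
have gP e : e \in R i -> g e \in B /\ e \in g e.
  move=> eR; rewrite /g; case: pickP => [S /andP[SB eS]|no]; first by split.
  have [S] := hAB _ _ eR; rewrite inE => /orP[SA|SB] eS.
    have := hi _ SA; rewrite negbK => /pred0P/(_ e) /=.
    by rewrite eR eS.
  by have := no S; rewrite SB eS.
rewrite -[leqLHS](cR i) -(@card_in_imset _ _ g).
  by apply: subset_leq_card; apply/subsetP => _ /imsetP[e /gP[gB _] ->].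
move=> e f eR fR eqg; apply/eqP/negPn/negP => nef.
have [gB eg] := gP _ eR; have [_ fg] := gP _ fR; rewrite -eqg in fg.
by have := hB _ gB _ _ eg fg; rewrite (h2 _ _ _ eR fR).
Qed.

Section Lower.
Context {d d' : Order.disp_t} {V : finOrderType d} {W : finOrderType d'}.
Variables (M : ograph V) (H : ograph W) (f : W -> V).
Hypothesis f_homo : {homo f : x y / (x < y)%O}.
Hypothesis f_adj : forall x y, adj H x y -> adj M (f x) (f y).

Definition map_edge (e : W * W) : V * V := (f e.1, f e.2).

Lemma map_edge_inj : injective map_edge.
Proof.
have f_inj : injective f.
  move=> u v; case: (ltgtP u v) => // /f_homo + eq_f; by rewrite eq_f ltxx.
by move=> [a b] [a' b'] [/f_inj-> /f_inj->].
Qed.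

Lemma map_edge_in e : e \in edges H -> map_edge e \in edges M.
Proof. by rewrite !inE => /andP[/f_homo-> /f_adj->]. Qed.

Lemma map_edge_cross e e' : cross e e' -> cross (map_edge e) (map_edge e').
Proof.
by rewrite /cross => /orP[] /and3P[/f_homo h1 /f_homo h2 /f_homo h3];
  rewrite h1 h2 h3 ?orbT.
Qed.

Lemma map_edge_nest e e' : nest e e' -> nest (map_edge e) (map_edge e').
Proof.
by rewrite /nest => /orP[] /and3P[/f_homo h1 /f_homo h2 /f_homo h3];
  rewrite h1 h2 h3 ?orbT.
Qed.

Lemma thick_pattern_pages k n :
  is_thick_pattern k H -> mixed_pages M n -> k <= n.
Proof.
move=> pat /existsP[s /existsP[St /existsP[Qu]]].
case/and5P=> part _ /eqP cSt /eqP cQu /andP[/forall_inP hSt /forall_inP hQu].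
have hStc (S : {set V * V}) : S \in St -> {in S &, forall e e', ~~ cross e e'}.
  by move=> /hSt/forall_inP h e e' /h/forall_inP; apply.
have hQun (S : {set V * V}) : S \in Qu -> {in S &, forall e e', ~~ nest e e'}.
  by move=> /hQu/forall_inP h e e' /h/forall_inP; apply.
have le_s : s <= n by rewrite -ltnS.
suff: k <= #|St| \/ k <= #|Qu| by rewrite cSt cQu; case=> /leq_trans; apply; rewrite ?leq_subr.
have hcov (R : 'I_k -> {set W * W}) : edges H = \bigcup_(i < k) R i ->
    forall i, {in map_edge @: R i, forall e, exists2 S, S \in St :|: Qu & e \in S}.
  move=> eqH i _ /imsetP[e eR ->].
  have : map_edge e \in cover (St :|: Qu).
    rewrite (cover_partition part); apply: map_edge_in.
    by rewrite eqH; apply/bigcupP; exists i.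
  by case/bigcupP=> S; exists S.
case: pat => [] [R [eqH hR _ hij]].
- apply: (@thick_le_blocks _ _ _ _ (@cross _ V) (@nest _ V) (fun i => map_edge @: R i)) => //.
  + by move=> i; rewrite (card_imset _ map_edge_inj); case: (hR i).
  + move=> i _ _ /imsetP[e eR ->] /imsetP[e' eR' ->] ne.
    apply: map_edge_nest; have [_ h] := hR i; apply: h => //.
    by apply: contraNneq ne => ->.
  + move=> i j nij _ _ /imsetP[e eR ->] /imsetP[e' eR' ->].
    exact/map_edge_cross/(hij i j).
  + exact: hcov.
(* For thick rainbows stacks and queues exchange roles. *)
- apply/or_comm.
  apply: (@thick_le_blocks _ _ _ _ (@nest _ V) (@cross _ V) (fun i => map_edge @: R i)) => //.
  + by move=> i; rewrite (card_imset _ map_edge_inj); case: (hR i).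
  + move=> i _ _ /imsetP[e eR ->] /imsetP[e' eR' ->] ne.
    apply: map_edge_cross; have [_ h] := hR i; apply: h => //.
    by apply: contraNneq ne => ->.
  + move=> i j nij _ _ /imsetP[e eR ->] /imsetP[e' eR' ->].
    exact/map_edge_nest/(hij i j).
  + by move=> i; rewrite setUC; apply: hcov.
Qed.

End Lower.

Lemma subgraph_of_edges d (V : finOrderType d) (M : ograph V) (F : {set V * V}) :
  F \subset edges M -> exists H : ograph V, edges H = F /\ contains M H.
Proof.
move=> /subsetP sF; pose a u v := ((u, v) \in F) || ((v, u) \in F).
have a_sym : symmetric a by move=> u v; rewrite /a orbC.
have a_irr : irreflexive a.
  by move=> u; rewrite /a orbb; apply/negP => /sF; rewrite inE ltxx.
exists (OGraph a_sym a_irr); split.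
  apply/setP => -[u v]; rewrite inE /= /a; apply/andP/idP.
    case=> lt_uv /orP[//|/sF]; rewrite inE /= => /andP[lt_vu _].
    by have := lt_trans lt_uv lt_vu; rewrite ltxx.
  by move=> uvF; have := sF _ uvF; rewrite inE uvF => /andP[->].
exists id; split=> // u v /= /orP[] /sF; rewrite inE => /andP[_] //.
by rewrite adj_sym.
Qed.

(** * Translation between separated matchings and point sets *)

Section Separated.
Context {d : Order.disp_t} {V : finOrderType d}.
Variables (M : ograph V) (V1 V2 : {set V}).
Hypotheses (hM : matching M) (hsep : separated M V1 V2).

Definition edge_type := {e : V * V | e \in edges M}.
Implicit Types p q : edge_type.

Definition rank (v : V) : int := #|[set w | (w < v)%O]|%:Z%R.

Lemma rank_lt u v : (rank u < rank v)%R = (u < v)%O.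
Proof.
rewrite /rank ltz_nat; have [lt_uv|le_vu] := ltP u v.
  apply: proper_card; apply/properP; split.
    by apply/subsetP => w; rewrite !inE => /lt_trans; apply.
  by exists u; rewrite !inE ?ltxx.
apply/negbTE; rewrite -leqNgt; apply: subset_leq_card.
by apply/subsetP => w; rewrite !inE => /lt_le_trans; apply.
Qed.

Lemma rank_inj : injective rank.
Proof.
by move=> u v eq_r; case: (ltgtP u v) => //; rewrite -rank_lt eq_r ltxx.
Qed.

Definition px p := rank (val p).1.
Definition py p := rank (val p).2.

Lemma edge_adj p : adj M (val p).1 (val p).2.
Proof. by case: p => e /=; rewrite inE => /andP[]. Qed.

Lemma px_inj : injective px.
Proof.
move=> p q /rank_inj eq1; apply: val_inj; have := edge_adj p; have := edge_adj q.
move: eq1; case: (val p) (val q) => [a b] [a' b'] /= -> h1 h2.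
by rewrite (hM h1 h2).
Qed.

Lemma py_inj : injective py.
Proof.
move=> p q /rank_inj eq1; apply: val_inj; have := edge_adj p; have := edge_adj q.
move: eq1; case: (val p) (val q) => [a b] [a' b'] /= ->.
by rewrite ![adj M _ b']adj_sym => h1 h2; rewrite (hM h1 h2).
Qed.

(** It makes the middle comparisons in [cross] and [nest] automatic, which leaves [inc] and
    [dec]. *)
Lemma edge_sep p q : ((val p).1 < (val q).2)%O.
Proof.
have [[_ _ hb] hlt] := hsep.
have hp (e : edge_type) : (val e).1 \in V1 /\ (val e).2 \in V2.
  have /hb/orP[/andP[] //|/andP[h1 h2]] := edge_adj e.
  case: e h1 h2 => e /=; rewrite inE => /andP[lt_e _] h1 h2.
  by have := lt_trans lt_e (hlt _ _ h2 h1); rewrite ltxx.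
by apply: hlt; [case: (hp p)|case: (hp q)].
Qed.

Lemma inc_cross p q : inc px py p q = cross (val p) (val q).
Proof.
rewrite /inc /below /cross /px /py !rank_lt.
by rewrite (edge_sep q p) (edge_sep p q) !andTb.
Qed.

Lemma dec_nest p q : dec px py p q = nest (val p) (val q).
Proof.
rewrite /dec /inc /below /neg /nest /px /py !ltrN2 !rank_lt.
have hlt (e : edge_type) : ((val e).1 < (val e).2)%O := edge_sep e e.
rewrite orbC; congr (_ || _).
  apply/andP/and3P => [[h1 h2]|[h1 _ h2]]; split=> //; exact: edge_sep.
apply/andP/and3P => [[h1 h2]|[h1 _ h2]]; split=> //; exact: edge_sep.
Qed.

(** Crossing and nesting each order all four endpoints strictly. *)
Lemma disjoint_endpoints (F F' : {set V * V}) :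
  {in F & F', forall e e', cross e e' || nest e e'} ->
  [disjoint endpoints F & endpoints F'].
Proof.
move=> hF; have ne e e' : e \in F -> e' \in F' ->
    [/\ e.1 != e'.1, e.1 != e'.2, e.2 != e'.1 & e.2 != e'.2].
  move=> eF eF'; have := hF _ _ eF eF'; rewrite /cross /nest.
  by move=> /orP[]/orP[] /and3P[h1 h2 h3];
    have h12 := lt_trans h1 h2; have h23 := lt_trans h2 h3;
    have h13 := lt_trans h12 h3; split;
    rewrite neq_lt ?h1 ?h2 ?h3 ?h12 ?h23 ?h13 ?orbT.
rewrite disjoints_subset; apply/subsetP => v; rewrite !inE negb_or.
by case/orP=> /imsetP[e eF ->]; apply/andP; split; apply/imsetP => -[e' eF' eqv];
  have [] := ne _ _ eF eF'; rewrite eqv eqxx.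
Qed.

Lemma pattern_of_sets k (R : 'I_k -> {set edge_type}) (r r' : rel edge_type) :
  (forall i, nclique k r (R i)) ->
  (forall i j, i != j -> {in R i & R j, forall p q, r' p q}) ->
  (r = dec px py /\ r' = inc px py) \/ (r = inc px py /\ r' = dec px py) ->
  contains_thick_pattern M k.
Proof.
move=> hR hij hr.
have sF : \bigcup_(i < k) (val @: R i) \subset edges M.
  by apply/bigcupsP => i _; apply/subsetP => _ /imsetP[p _ ->]; apply: valP.
have [H [eqH cH]] := subgraph_of_edges sF.
exists d, V, H; split=> //.
have cR i : #|val @: R i| = k.
  by rewrite (card_imset _ val_inj); have /andP[/eqP] := hR i.
have clR i : {in R i &, forall p q, val p != val q -> r p q}.
  move=> p q pR qR npq; have /andP[_ /cliqueP cl] := hR i.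
  by apply: cl => //; apply: contraNneq npq => ->.
case: hr => -[er er']; [left|right]; exists (fun i => val @: R i); split=> //.
- move=> i; split=> [|_ _ /imsetP[p pR ->] /imsetP[q qR ->]]; first exact: cR.
  by rewrite -dec_nest -er; apply: (clR i p q pR qR).
- move=> i j nij; apply: disjoint_endpoints.
  move=> _ _ /imsetP[p pR ->] /imsetP[q qR ->].
  by rewrite -inc_cross -er' (hij i j).
- move=> i j nij _ _ /imsetP[p pR ->] /imsetP[q qR ->].
  by rewrite -inc_cross -er' (hij i j).
- move=> i; split=> [|_ _ /imsetP[p pR ->] /imsetP[q qR ->]]; first exact: cR.
  by rewrite -inc_cross -er; apply: (clR i p q pR qR).
- move=> i j nij; apply: disjoint_endpoints.
  move=> _ _ /imsetP[p pR ->] /imsetP[q qR ->].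
  by rewrite -dec_nest -er' (hij i j) ?orbT.
- move=> i j nij _ _ /imsetP[p pR ->] /imsetP[q qR ->].
  by rewrite -dec_nest -er' (hij i j).
Qed.

Lemma cover_mn m : mono_cover (inc px py) (dec px py) m setT -> mn M <= m.
Proof.
case=> F [sF hF cF]; pose F' := [seq val @: (A : {set edge_type}) | A <- F].
(* Assigning each edge to the first set that contains it makes the cover disjoint. *)
pose idx e := find (fun A : {set V * V} => e \in A) F'.
have idxP e : e \in edges M -> idx e < size F /\ e \in nth set0 F' (idx e).
  move=> eM; have [A AF pA] := cF (Sub e eM) (in_setT _).
  have hs : has (fun A : {set V * V} => e \in A) F'.
    apply/hasP; exists (val @: A); first exact: map_f.
    by apply/imsetP; exists (Sub e eM).
  split; last exact: (nth_find set0 hs).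
  by rewrite -(size_map (fun A : {set edge_type} => val @: A) F) -has_find.
pose P := preim_partition idx (edges M).
have partP : partition P (edges M) by apply: preim_partitionP.
(* Increasing sequences have no nesting pair and give queues; decreasing ones give stacks. *)
have hP B : B \in P -> is_stack B || is_queue B.
  case/imsetP=> e eM ->; have [lt_i _] := idxP e eM.
  have hB e' : e' \in [set y in edges M | idx e == idx y] ->
      exists2 p : edge_type, p \in nth set0 F (idx e) & e' = val p.
    rewrite inE => /andP[/idxP[_ +] /eqP eqi].
    by rewrite -eqi (nth_map set0) // => /imsetP.
  have /orP[/cliqueP cl|/cliqueP cl] := hF _ (mem_nth set0 lt_i).
    apply/orP; right; apply/forall_inP => _ /hB[p pA ->].
    apply/forall_inP => _ /hB[q qA ->]; rewrite -dec_nest.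
    have [->|npq] := eqVneq p q; first by rewrite /dec /inc /below !ltxx.
    have := inc_dec px_inj py_inj npq; rewrite (cl p q pA qA npq) /=.
    by move/negbTE->.
  apply/orP; left; apply/forall_inP => _ /hB[p pA ->].
  apply/forall_inP => _ /hB[q qA ->]; rewrite -inc_cross.
  have [->|npq] := eqVneq p q; first by rewrite /inc /below !ltxx.
  have := inc_dec px_inj py_inj npq; rewrite (cl p q pA qA npq) addbT.
  by [].
have cP : #|P| <= size F.
  have sP : P \subset [set [set y in edges M | nat_of_ord i == idx y] | i : 'I_(size F)].
    apply/subsetP => _ /imsetP[e eM ->]; have [lt_i _] := idxP e eM.
    by apply/imsetP; exists (Ordinal lt_i).
  apply: leq_trans (subset_leq_card sP) _.
  by rewrite -[leqRHS]card_ord; apply: leq_imset_card.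
(* Blocks that are both a stack and a queue are counted as stacks. *)
pose St := [set B in P | is_stack B]; pose Qu := P :\: St.
have sSt : St \subset P by apply/subsetP => B; rewrite inE => /andP[].
have cSQ : #|Qu| = #|P| - #|St| by rewrite cardsD (setIidPr sSt).
rewrite /mn; case: ex_minnP => n _ nmin.
apply: leq_trans sF; apply: leq_trans cP; apply: nmin.
have lt_s : #|St| < #|P|.+1 by rewrite ltnS subset_leq_card.
apply/existsP; exists (Ordinal lt_s) => /=.
apply/existsP; exists St; apply/existsP; exists Qu; apply/and5P; split=> //.
- suff -> : St :|: Qu = P by [].
  by apply/setP => B; rewrite !inE; case: (B \in P); case: is_stack.
- rewrite disjoint_sym disjoints_subset; apply/subsetP => B.
  by rewrite in_setD in_setC => /andP[].
- by rewrite cSQ.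
apply/andP; split; apply/forall_inP => B.
  by rewrite inE => /andP[].
rewrite !inE => /andP[+ BP]; rewrite BP /= => nst.
by have := hP B BP; rewrite (negbTE nst).
Qed.

End Separated.

Theorem theorem6 (d : Order.disp_t) (V : finOrderType d) (M : ograph V)
    (V1 V2 : {set V}) (k : nat)
    (hM : matching M)
    (hsep : separated M V1 V2)
    (hk : contains_thick_pattern M k)
    (hmax : forall k' : nat, contains_thick_pattern M k' -> k' <= k) :
  k <= mn M <= 2 * k ^ 7.
Proof.
apply/andP; split.
  rewrite /mn; case: ex_minnP => n hn _.
  have [d' [W [H [pat [f [f_homo f_adj]]]]]] := hk.
  exact: (thick_pattern_pages f_homo f_adj pat hn).
pose x := @px d V M; pose y := @py d V M.
have hx : injective x := px_inj hM.
have hy : injective y := py_inj hM.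
have thin1 : thin (inc x y) (dec x y) k.+1.
  case=> R [hR hij]; have := hmax k.+1; rewrite ltnn => /(_ _)/negP; case=> //.
  by apply: (pattern_of_sets hsep hR hij); left.
have thin2 : thin (dec x y) (inc x y) k.+1.
  case=> R [hR hij]; have := hmax k.+1; rewrite ltnn => /(_ _)/negP; case=> //.
  by apply: (pattern_of_sets hsep hR hij); right.
apply: (cover_mn hM hsep); rewrite -/x -/y.
case: k {hk hmax} thin1 thin2 => [|[|k]] thin1 thin2.
(* For k = 0 there is no edge, since a single edge is a 1-thick 1-twist. *)
- suff -> : [set: edge_type M] = set0 by apply: mono_cover0.
  apply/setP => p; rewrite !inE; apply/negP => _; apply: thin1.
  exists (fun=> [set p]); split=> [i|i j]; last by rewrite !ord1 eqxx.
  rewrite /nclique cards1 eqxx; apply/cliqueP => a b /set1P-> /set1P->.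
  by rewrite eqxx.
(* For k = 1 the bound is 2: a clique and an independent set of the crossing graph. *)
- apply: (@split_cover _ (below x y)) => //.
  + exact: below_irr.
  + exact: below_trans.
  + by move=> p q; rewrite /dec /inc orbC.
  + by move=> p q; apply: inc_dec.
- apply: (mono_coverS (total_cost_le (isT : 1 < k.+2)) (subxx _)).
  exact: thin_cover.
Qed.
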